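(* Let $\Lambda_{TU}=\{(F(x),\Lambda_x,v(x))\}_{x\in X}$ be a continuous $(T,U)$-controlled $g$-fusion frame for $H$ with frame bounds $A,B$, and let $S_C$ be its frame operator. Assume that $S_C^{-1}$ commutes with $T$ and $U$. Put $T_x=\Lambda_xP_{F(x)}S_C^{-1}$ for $x\in X$. Then $\{v^2(x)\,T^*P_{F(x)}\Lambda_x^*T_xU\}_{x\in X}$ is a continuous resolution of the identity operator on $H$. Furthermore, for each $f\in H$, $$\frac{A}{B^2}\|f\|^2\le\int_X v^2(x)\,\langle T_xUf,\,T_xTf\rangle\,d\mu_x\le\frac{B}{A^2}\|f\|^2 .$$
   Context: $H$ is a separable Hilbert space, $\mathbb H$ is the collection of all closed subspaces of $H$, and $(X,\mu)$ is a measure space with positive measure $\mu$; $d\mu_x$ denotes integration with respect to $\mu$ in the variable $x$. $P_M$ is the orthogonal projection of $H$ onto a closed subspace $M$ (when followed by an operator defined on $M$ it is regarded as a map $H\to M$; its adjoint is then the inclusion $M\to H$). An operator is positive if it is self-adjoint and $\langle Sf,f\rangle\ge 0$ for all $f$; $\mathcal{GB}^+(H)$ is the set of positive bounded operators on $H$ with bounded inverse. Definition. Let $F:X\to\mathbb H$ be a mapping, $v:X\to\mathbb R^+$ measurable, $\{K_x\}_{x\in X}$ Hilbert spaces, $\Lambda_x:F(x)\to K_x$ bounded linear for each $x\in X$, and $T,U\in\mathcal{GB}^+(H)$. The family $\Lambda_{TU}$ is a continuous $(T,U)$-controlled $g$-fusion frame for $H$ with bounds $A,B$ ($0<A\le B<\infty$)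 if (i) for each $f\in H$ the mapping $x\mapsto P_{F(x)}f$ is measurable, and (ii) for all $f\in H$ $$A\|f\|^2\le\int_X v^2(x)\langle\Lambda_xP_{F(x)}Uf,\Lambda_xP_{F(x)}Tf\rangle\,d\mu_x\le B\|f\|^2 .$$ Its frame operator is the unique bounded linear operator $S_C$ on $H$ with $\langle S_Cf,g\rangle=\int_X v^2(x)\langle T^*P_{F(x)}\Lambda_x^*\Lambda_xP_{F(x)}Uf,g\rangle\,d\mu_x$ for all $f,g\in H$; it is self-adjoint and satisfies $A\,I_H\le S_C\le B\,I_H$, so it is invertible. A family $\{R_x\}_{x\in X}$ of bounded operators on $H$ is a continuous resolution of the identity operator on $H$ if for all $f,g\in H$ the function $x\mapsto\langle R_xf,g\rangle$ is measurable on $X$ and $\langle f,g\rangle=\int_X\langle R_xf,g\rangle\,d\mu_x$. *)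

(* Defs.v *)
From HB Require Import structures.
From mathcomp Require Import all_boot all_order all_algebra.
From mathcomp Require Import complex.
From mathcomp Require Import all_classical all_reals all_analysis.

Set Implicit Arguments.
Unset Strict Implicit.
Unset Printing Implicit Defensive.

Import Order.TTheory GRing.Theory Num.Theory.
Import numFieldNormedType.Exports.

Local Open Scope classical_set_scope.
Local Open Scope ring_scope.
Local Open Scope complex_scope.

(* Complex Hilbert spaces. The inner product is linear in its first argument
   and conjugate-linear in the second; norms take values in R[i], where
   x <= y means that y - x is a nonnegative real. *)
HB.mixin Record CompleteNormedModule_isHilbert (R : realType) V
    of CompleteNormedModule R[i] V := {
  inner : {dot V for Num.conj} ;
  innerE : forall v : V, inner v v = `|v| ^+ 2
}.

#[short(type="hilbertType")]
HB.structure Definition Hilbert (R : realType) :=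
  { V of CompleteNormedModule R[i] V & CompleteNormedModule_isHilbert R V }.

Notation "''[' u , v ]" := (inner u v) : ring_scope.

Definition separable (T : topologicalType) : Prop :=
  exists D : set T, countable D /\ dense D.

Record closedSubspace (R : realType) (H : hilbertType R) := ClosedSubspace {
  csub_pred : {pred H} ;
  csub_submod : submod_closed csub_pred ;
  csub_closed : closed [set x | x \in csub_pred] }.

Section closedSubspace_hilbert.
Context {R : realType} {H : hilbertType R}.

HB.instance Definition _ (M : closedSubspace H) :=
  GRing.isSubmodClosed.Build R[i] H (csub_pred M) (csub_submod M).

Variable M : closedSubspace H.

Record csub_sort := CSub { csub_val : H ; _ : csub_val \in csub_pred M }.

HB.instance Definition _ := [isSub for csub_val].
HB.instance Definition _ := [Choice of csub_sort by <:].
HB.instance Definition _ := [SubChoice_isSubZmodule of csub_sort by <:].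
HB.instance Definition _ := [SubZmodule_isSubLmodule of csub_sort by <:].

Definition csub_norm (x : csub_sort) : R[i] := `|val x|.

Fact csub_ler_normD x y : csub_norm (x + y) <= csub_norm x + csub_norm y.
Proof. by rewrite /csub_norm raddfD ler_normD. Qed.

Fact csub_normrZ (l : R[i]) x : csub_norm (l *: x) = `|l| * csub_norm x.
Proof. by rewrite /csub_norm linearZ normrZ. Qed.

Fact csub_normr0_eq0 x : csub_norm x = 0 -> x = 0.
Proof. by move=> /normr0_eq0 x0; apply: val_inj; rewrite x0 raddf0. Qed.

HB.instance Definition _ := @Lmodule_isNormed.Build R[i] csub_sort csub_norm
  csub_ler_normD csub_normrZ csub_normr0_eq0.

Lemma csub_ballE (x : csub_sort) (e : R[i]) :
  ball x e = val @^-1` ball (val x) e.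
Proof.
by apply/seteqP; split=> y;
  rewrite /= -!ball_normE /ball_/= /Num.norm /= /csub_norm raddfB.
Qed.

Lemma csub_complete (G : set_system csub_sort) :
  ProperFilter G -> cauchy G -> cvg G.
Proof.
move=> PG /cauchyP cG.
pose G' : set_system H := (val : csub_sort -> H) @ G.
have PG' : ProperFilter G' by exact: fmap_proper_filter.
have : cauchy G'.
  apply: cauchy_exP => e e0; have [x Gx] := cG e e0.
  by exists (val x); rewrite /G' /= /nbhs /= -csub_ballE.
move=> /cauchy_cvg /cvg_ex[l Gl].
have lM : l \in csub_pred M.
  apply: (closed_cvg _ (@csub_closed _ _ M) _ l Gl).
  by apply: nearW => x; apply: valP.
apply/cvg_ex; exists (CSub lM); apply/cvg_ballP => e e0.
have /cvg_ballP/(_ e e0) := Gl.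
by rewrite /prop_near1 /nbhs /= csub_ballE.
Qed.

HB.instance Definition _ := Uniform_isComplete.Build csub_sort csub_complete.

Definition csub_inner (u v : csub_sort) : R[i] := '[val u, val v].

Fact csub_inner_bilinear :
  bilinear_for *%R (Num.conj \; *%R : R[i] -> R[i] -> R[i]) csub_inner.
Proof.
split=> u a x y; rewrite /csub_inner.
  by rewrite [val _]linearP linearPl.
by rewrite [val (_ + _)]linearP linearPr.
Qed.

HB.instance Definition _ :=
  @bilinear_isBilinear.Build R[i] csub_sort csub_sort R[i] _ _
    csub_inner csub_inner_bilinear.

Fact csub_inner_herm u v :
  csub_inner u v = (-1) ^+ false * Num.conj (csub_inner v u).
Proof. exact: hermC. Qed.

HB.instance Definition _ :=
  @isHermitianSesquilinear.Build R[i] csub_sort false Num.conj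
    csub_inner csub_inner_herm.

Fact csub_inner_gt0 u : u != 0 -> 0 < csub_inner u u.
Proof. by move=> u0; rewrite /csub_inner neq0_dnorm_gt0. Qed.

HB.instance Definition _ :=
  @isDotProduct.Build R[i] csub_sort csub_inner csub_inner_gt0.

Fact csub_innerE u : csub_inner u u = `|u| ^+ 2.
Proof. exact: innerE. Qed.

HB.instance Definition _ :=
  @CompleteNormedModule_isHilbert.Build R csub_sort csub_inner csub_innerE.

End closedSubspace_hilbert.

Coercion csub_sort : closedSubspace >-> Sortclass.

Section operators.
Context {R : realType}.
Implicit Types E F H : hilbertType R.

Definition bounded_operator E F (A : E -> F) : Prop :=
  linear A /\ exists c : R, forall x, `|A x| <= c%:C * `|x|.

(* On bounded operators the defining property has exactly one solution
   (Riesz); elsewhere the value is irrelevant. *)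
Definition adjoint E F (A : E -> F) : F -> E :=
  fun y => xget 0 [set z | forall x, '[A x, y] = '[x, z]].

(* The orthogonal projection onto M, as a map H -> M. *)
Definition orthproj H (M : closedSubspace H) : H -> M :=
  fun f => xget 0 [set p | forall m : M, '[f - val p, val m] = 0].

Definition opinv H (A : H -> H) : H -> H :=
  fun y => xget 0 [set x | A x = y].

Definition positive_operator H (A : H -> H) : Prop :=
  adjoint A = A /\ forall f, 0 <= '[A f, f].

Definition GBplus H (A : H -> H) : Prop :=
  [/\ bounded_operator A, positive_operator A &
      exists B, [/\ bounded_operator B, cancel A B & cancel B A]].

End operators.

Section complex_integral.
Context {d : measure_display} {X : measurableType d} {R : realType}.
Implicit Types (mu : {measure set X -> \bar R}) (h : X -> R[i]).

Definition cmeasurable h : Prop :=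
  measurable_fun setT (fun x => complex.Re (h x)) /\
  measurable_fun setT (fun x => complex.Im (h x)).

Definition cintegrable mu h : Prop :=
  mu.-integrable setT (fun x => (complex.Re (h x))%:E) /\
  mu.-integrable setT (fun x => (complex.Im (h x))%:E).

Definition cintegral mu h : R[i] :=
  (\int[mu]_x complex.Re (h x)) +i* (\int[mu]_x complex.Im (h x)).

Definition borel_measurable {T : ptopologicalType} (u : X -> T) : Prop :=
  measurable_fun setT (u : X -> g_sigma_algebraType (@open T)).

End complex_integral.

Section frames.
Context {d : measure_display} {X : measurableType d} {R : realType}.
Variable mu : {measure set X -> \bar R}.
Variables (H : hilbertType R) (K : X -> hilbertType R).
Variables (F : X -> closedSubspace H) (v : X -> R).
Variable Lambda : forall x, F x -> K x.
Arguments Lambda : clear implicits.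
Variables T U : H -> H.

Definition controlled_gfusion_frame (A B : R) : Prop :=
  [/\ [/\ measurable_fun setT v, forall x, 0 <= v x,
          forall x, bounded_operator (Lambda x), GBplus T & GBplus U],
      0 < A <= B,
      forall f : H, borel_measurable (fun x => val (orthproj (F x) f)) &
      forall f : H,
        let h x := (v x ^+ 2)%:C * '[Lambda x (orthproj (F x) (U f)),
                                     Lambda x (orthproj (F x) (T f))] in
        cintegrable mu h /\
        A%:C * `|f| ^+ 2 <= cintegral mu h <= B%:C * `|f| ^+ 2].

(* In P_{F(x)} Lambda_x^*, the vector Lambda_x^* y of F(x) is viewed in H
   and the projection is H -> H, hence the two occurrences of val. *)
Definition frame_operator (S : H -> H) : Prop :=
  bounded_operator S /\
  forall f g : H,
    let h x := (v x ^+ 2)%:C *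
      '[adjoint T (val (orthproj (F x) (val
          (adjoint (Lambda x) (Lambda x (orthproj (F x) (U f))))))), g] in
    cintegrable mu h /\ '[S f, g] = cintegral mu h.

Definition resolution_of_identity (Q : X -> H -> H) : Prop :=
  (forall x, bounded_operator (Q x)) /\
  forall f g : H,
    [/\ cmeasurable (fun x => '[Q x f, g]),
        cintegrable mu (fun x => '[Q x f, g]) &
        '[f, g] = cintegral mu (fun x => '[Q x f, g])].

End frames.

(* Main.v *)
Require Import Defs.
From HB Require Import structures.
From mathcomp Require Import all_boot all_order all_algebra.
From mathcomp Require Import complex.
From mathcomp Require Import all_classical all_reals all_analysis.
From mathcomp Require Import ring lra.

Set Implicit Arguments.
Unset Strict Implicit.
Unset Printing Implicit Defensive.

Import Order.TTheory GRing.Theory Num.Theory.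
Import numFieldNormedType.Exports.

Local Open Scope classical_set_scope.
Local Open Scope ring_scope.
Local Open Scope complex_scope.

(** Unfolding the adjoints, the integrand that defines [SC] at [f], [g] is
    [v x ^+ 2 * '[Lambda_x P_x U f, Lambda_x P_x T g]], where [P_x] is the
    orthogonal projection onto [F x].  So on the diagonal the frame inequality
    says [A |f|^2 <= '[SC f, f] <= B |f|^2].  A complex operator with a real
    quadratic form is self-adjoint, and one that is moreover bounded below by
    [A] is bijective, so [opinv SC] is a true inverse.  Since it commutes with
    [U], the operator in the resolution integrates weakly to
    [SC (opinv SC f) = f]; since it commutes with [U] and [T], the second
    integral at [f] is the frame integral at [g := opinv SC f] and so lies
    between [A |g|^2] and [B |g|^2].  The constants then come from
    [A |g| <= |SC g| <= B |g|] with [SC g = f]; the upper half is the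
    Cauchy-Schwarz inequality of the form ['[SC x, y]] at [x := g], [y := SC g].

    All existence questions (Riesz representation, hence adjoints and
    orthogonal projections, and surjectivity of [SC]) are instances of a single
    statement, [coercive_form_representation]: a bounded linear functional is
    represented by any inner product equivalent to the given one.  For the
    given inner product this is Riesz; applied in the subspace [F x] it yields
    the projection; for ['[SC x, y]] it says that [SC] is onto. *)

(** * Squared moduli of complex numbers *)
Section complex_facts.
Context {R : realType}.
Implicit Types z w : R[i].

Definition sqmod z : R := complex.Re z ^+ 2 + complex.Im z ^+ 2.

Lemma sqmodE z : `|z| ^+ 2 = (sqmod z)%:C.
Proof. by rewrite -add_Re2_Im2. Qed.

Lemma sqmod_ge0 z : 0 <= sqmod z.
Proof. by rewrite addr_ge0 ?sqr_ge0. Qed.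

Lemma sqmod_eq0 z : sqmod z = 0 -> z = 0.
Proof.
move=> z0; apply/eqP; rewrite -normr_eq0 -sqrf_eq0 sqmodE z0; exact/eqP.
Qed.

Lemma sqmodN z : sqmod (- z) = sqmod z.
Proof. by case: z => a b; rewrite /sqmod /= !sqrrN. Qed.

Lemma sqmodD_le z w : sqmod (z + w) <= 2 * (sqmod z + sqmod w).
Proof.
case: z w => [a b] [c e]; rewrite /sqmod /=.
have := sqr_ge0 (a - c); have := sqr_ge0 (b - e); nra.
Qed.

(** The complex discriminant inequality: evaluating at the minimizer
    [s = conj w / k] leaves [e - |w|^2 / k].  It serves twice, for
    Cauchy-Schwarz and to bound the gradient at an approximate minimum. *)
Lemma complex_discriminant (e k : R) w : 0 <= k ->
  (forall s : R[i], 0 <= e - 2 * complex.Re (s * w) + sqmod s * k) ->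
  sqmod w <= e * k.
Proof.
move=> k0 quad.
have line (t : R) : 0 <= e - 2 * t * sqmod w + t ^+ 2 * sqmod w * k.
  have := quad (t%:C * Num.conj w); case: w {quad} => a b.
  by rewrite /sqmod /= => H; nra.
have := sqmod_ge0 w; move: (sqmod w) line => N line N0.
(* without quadratic term, the linear one is unbounded below unless w = 0 *)
have [kE|kN] := eqVneq k 0.
  rewrite kE mulr0 leNgt; apply/negP => Npos.
  have := line ((e + 1) / (2 * N)); rewrite kE mulr0 addr0.
  have -> : 2 * ((e + 1) / (2 * N)) * N = e + 1 by field; rewrite gt_eqF.
  lra.
have {kN}kpos : 0 < k by rewrite lt_def kN.
have := line k^-1.
have -> : e - 2 * k^-1 * N + k^-1 ^+ 2 * N * k = (e * k - N) / k
  by field; rewrite gt_eqF.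
by rewrite pmulr_lge0 ?invr_gt0// subr_ge0.
Qed.

End complex_facts.

(** * Inner products as real quadratic forms *)
Section forms.
Context {R : realType} {V : lmodType R[i]}.
Variable a : {dot V for Num.conj}.

Definition qform (u : V) : R := complex.Re (a u u).

Lemma qformE u : a u u = (qform u)%:C.
Proof. by rewrite /qform RRe_real// ger0_real// dnorm_ge0. Qed.

Lemma qform_ge0 u : 0 <= qform u.
Proof. by rewrite -ler0c -qformE dnorm_ge0. Qed.

Lemma form_conj u v : a u v = Num.conj (a v u).
Proof. by rewrite hermC mul1r. Qed.

Lemma qformD x s u :
  qform (x + s *: u) = qform x + 2 * complex.Re (s * a u x) + sqmod s * qform u.
Proof.
rewrite /qform dnormD dnormZ sqmodE !qformE linearZr_LR /= [a x u]form_conj.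
move: (a u x) (qform x) (qform u) => [w1 w2] p q.
by case: s => s1 s2; rewrite /sqmod /=; ring.
Qed.

(** The quadratic [s |-> qform (v - s *: u)] is nonnegative, so its
    discriminant is not positive. *)
Lemma cauchy_schwarz u v : sqmod (a u v) <= qform u * qform v.
Proof.
rewrite mulrC; apply: complex_discriminant; first exact: qform_ge0.
move=> s; have := qform_ge0 (v + (- s) *: u).
by rewrite qformD sqmodN mulNr raddfN mulrN.
Qed.

End forms.

(** * Real-valued norm of a Hilbert space *)
Section hilbert_norm.
Context {R : realType} {H : hilbertType R}.
Implicit Types x y : H.

(** The norm takes values in the nonnegative part of [R[i]]; its real part
    makes it available to the order theory of [R]. *)
Definition hnorm x : R := complex.Re `|x|.

Lemma hnormE x : `|x| = (hnorm x)%:C.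
Proof. by rewrite /hnorm RRe_real// ger0_real. Qed.

Lemma hnorm_ge0 x : 0 <= hnorm x.
Proof. by rewrite -ler0c -hnormE. Qed.

Lemma qform_inner x : qform inner x = hnorm x ^+ 2.
Proof. by apply: complexI; rewrite -qformE innerE hnormE rmorphXn. Qed.

Lemma ball_hnorm x y (r : R) : ball x r%:C y <-> hnorm (x - y) < r.
Proof. by rewrite -ball_normE /ball_ /= hnormE ltcR. Qed.

Lemma inner_eq_l x y : (forall z, '[z, x] = '[z, y]) -> x = y.
Proof.
move=> xy; apply/eqP; rewrite -subr_eq0 -(dnorm_eq0 inner).
by rewrite linearBr /= xy subrr.
Qed.

End hilbert_norm.

(** * Representation of functionals by an equivalent inner product *)

(** The representing vector minimizes [J x = a x x - 2 Re (phi x)].  By the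
    parallelogram identity points where [J] is close to its infimum are close
    to each other, so the sublevel sets of [J] generate a Cauchy filter; let
    [z] be its limit.  At a point [x] with [J x] within [e] of the infimum, the
    discriminant inequality bounds [|phi u - a u x|^2] by [e * a u u], and this
    estimate passes to the limit [z] because [a] is bounded. *)
Lemma coercive_form_representation (R : realType) (H : hilbertType R)
    (a : {dot H for Num.conj}) (alpha beta c : R) (phi : H -> R[i]) :
  0 < alpha -> 0 < beta ->
  (forall x, alpha * hnorm x ^+ 2 <= qform a x) ->
  (forall x, qform a x <= beta * hnorm x ^+ 2) ->
  scalar phi -> (forall x, `|phi x| <= c%:C * `|x|) ->
  exists z, forall x, phi x = a x z.
Proof.
move=> alpha0 beta0 a_ge a_le phi_lin phi_le.
pose J x := qform a x - 2 * complex.Re (phi x).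
have phiP s u x : phi (x + s *: u) = phi x + s * phi u.
  by rewrite addrC phi_lin addrC.
have JD x s u : J (x + s *: u) =
    J x - 2 * complex.Re (s * (phi u - a u x)) + sqmod s * qform a u.
  rewrite /J qformD phiP mulrBr.
  by rewrite !raddfD /= raddfN /=; ring.
(* completing the square in alpha |x|^2 - 2 c |x| *)
have J_lb x : - (c ^+ 2 / alpha) <= J x.
  have phix : complex.Re (phi x) <= c * hnorm x.
    rewrite -lecR rmorphM /= -hnormE; apply: le_trans (phi_le x).
    by apply: le_trans (normc_ge_Re _); rewrite lecR ler_norm.
  have H1 : alpha * J x + c ^+ 2 >= (alpha * hnorm x - c) ^+ 2.
    rewrite /J; have := a_ge x; nra.
  have : 0 <= alpha * (J x + c ^+ 2 / alpha).
    have -> : alpha * (J x + c ^+ 2 / alpha) = alpha * J x + c ^+ 2.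
      by field; rewrite gt_eqF.
    by apply: le_trans H1; rewrite sqr_ge0.
  by rewrite pmulr_rge0// -lerBlDr sub0r.
pose E := range J; pose del := inf E.
have EI : has_inf E.
  split; first by exists (J 0), 0.
  by exists (- (c ^+ 2 / alpha)) => _ [x _ <-].
have del_le x : del <= J x by apply: ge_inf; [case: EI | exists x].
pose D (e : R) := [set x | J x < del + e].
have D_gradient e x u : D e x -> sqmod (phi u - a u x) <= e * qform a u.
  move=> Dx; apply: complex_discriminant; first exact: qform_ge0.
  move=> s; have := del_le (x + s *: u); rewrite JD; move: Dx.
  by rewrite /D /=; lra.
have D_diam e x y : D e x -> D e y -> alpha * hnorm (x - y) ^+ 2 <= 4 * e.
  move=> Dx Dy; apply: le_trans (a_ge _) _.
  (* x and y are symmetric about their midpoint m *)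
  pose h := x - y; pose s : R[i] := (2^-1)%:C; pose m := y + s *: h.
  have sN : sqmod s = 4^-1 by rewrite /sqmod /=; field.
  have sD : s + s = 1.
    by apply/eqP; rewrite eq_complex /= addr0 eqxx andbT; apply/eqP; field.
  have xE : x = m + s *: h.
    rewrite /m -addrA -scalerDl sD scale1r.
    by rewrite addrC subrK.
  have yE : y = m + (- s) *: h by rewrite scaleNr addrK.
  have := del_le m; move: Dx Dy; rewrite /D /= [in J x]xE [in J y]yE !JD.
  by rewrite sqmodN sN mulNr raddfN /= -/h; lra.
pose G := filter_from [set e : R | 0 < e] D.
have PG : ProperFilter G.
  apply: filter_from_proper.
    apply: filter_from_filter; first by exists 1 => /=.
    move=> e1 e2 e10 e20; exists (Num.min e1 e2); first by rewrite /= lt_min e10.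
    by move=> x; rewrite /D /= -ltrBlDl lt_min !ltrBlDl => /andP[].
  move=> e e0; have [_ [x _ <-] Jx] := inf_adherent e0 EI.
  by exists x.
have : cauchy G.
  apply/cauchyP => e e0.
  have {e0} [r r0 ->] : exists2 r : R, 0 < r & e = r%:C.
    have eE : (complex.Re e)%:C = e by rewrite RRe_real// gtr0_real.
    by exists (complex.Re e); rewrite ?eE// -ltcR eE.
  pose d := alpha * r ^+ 2 / 8.
  have d0 : 0 < d by rewrite divr_gt0// mulr_gt0// exprn_gt0.
  have [x Dx] : D d !=set0.
    by have [_ [x _ <-] Jx] := inf_adherent d0 EI; exists x.
  exists x, d => // y Dy; apply/ball_hnorm.
  have := D_diam d x y Dx Dy.
  have -> : 4 * d = alpha * (r ^+ 2 / 2) by rewrite /d; field.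
  rewrite ler_pM2l// => xy.
  rewrite -(@ltr_pXn2r _ 2) ?nnegrE ?hnorm_ge0 ?ltW//.
  apply: le_lt_trans xy _; rewrite ltr_pdivrMr// mulr2n mulrDr mulr1.
  by rewrite ltrDl exprn_gt0.
move=> /cauchy_cvg /cvg_ex[z Gz].
exists z => u.
have near_z r e : 0 < r -> 0 < e -> exists2 x, D e x & hnorm (x - z) < r.
  move=> r0 e0; have GD : G (D e) by exists e.
  have Gb : G (ball z r%:C) by apply: Gz; apply: nbhsx_ballx; rewrite ltcR.
  have [x [Dx /ball_hnorm zx]] := filter_ex (filterI GD Gb).
  by exists x => //; rewrite /hnorm distrC.
apply/eqP; rewrite -subr_eq0; apply/eqP; apply: sqmod_eq0.
set w := phi u - a u z.
have w_le e : 0 < e -> sqmod w <= 4 * qform a u * e.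
  move=> e0.
  (* this radius makes qform a (x - z) <= beta * r ^+ 2 = e *)
  pose r := Num.sqrt (e / beta).
  have r0 : 0 < r by rewrite sqrtr_gt0 divr_gt0.
  have [x Dx xz] := near_z r e r0 e0.
  have -> : w = phi u - a u x + a u (x - z) by rewrite linearBr /= addrA subrK.
  apply: le_trans (sqmodD_le _ _) _.
  have H1 := D_gradient e x u Dx.
  have H2 := cauchy_schwarz a u (x - z).
  have H3 : qform a (x - z) <= e.
    apply: le_trans (a_le _) _.
    have -> : e = beta * r ^+ 2.
      by rewrite sqr_sqrtr ?divr_ge0 ?ltW// mulrC divfK// gt_eqF.
    by rewrite ler_pM2l// ler_pXn2r ?nnegrE ?hnorm_ge0 ?ltW.
  have H4 : qform a u * qform a (x - z) <= qform a u * e.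
    by rewrite ler_wpM2l ?qform_ge0.
  lra.
apply/eqP; rewrite eq_le sqmod_ge0 andbT; apply/ler_addgt0Pl => e e0.
pose k := 4 * qform a u + 1.
have k0 : 0 < k by rewrite ltr_wpDl// mulr_ge0 ?qform_ge0.
rewrite addr0; apply: le_trans (w_le (e / k) _) _; first by rewrite divr_gt0.
by rewrite mulrA ler_pdivrMr// mulrC ler_pM2l// lerDl.
Qed.

(** * Adjoints, projections and bounded operators *)
Section bounded_operators.
Context {R : realType}.
Implicit Types E F G H : hilbertType R.

Lemma inner_le H (x y : H) : `|'[x, y]| <= `|x| * `|y|.
Proof.
rewrite -(@ler_pXn2r _ 2) ?nnegrE ?mulr_ge0// exprMn -!innerE sqmodE !qformE.
by rewrite -rmorphM lecR cauchy_schwarz.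
Qed.

Theorem riesz_representation H (c : R) (phi : H -> R[i]) :
  scalar phi -> (forall x, `|phi x| <= c%:C * `|x|) ->
  exists z, forall x, phi x = '[x, z].
Proof.
by apply: (@coercive_form_representation _ _ inner 1 1) => // x;
  rewrite qform_inner mul1r.
Qed.

Lemma adjointP E F (A : E -> F) : bounded_operator A ->
  forall x y, '[A x, y] = '[x, adjoint A y].
Proof.
move=> [A_lin [c A_le]] x y.
suff /(xgetPex 0) : exists z, forall x, '[A x, y] = '[x, z] by exact.
apply: (@riesz_representation _ (c * hnorm y)) => [k u w|t].
  by rewrite A_lin linearPl.
apply: le_trans (inner_le _ _) _.
by rewrite rmorphM /= -hnormE mulrAC ler_wpM2r.
Qed.

(** The projection of [f] is the vector of [M], itself a Hilbert space, that
    represents the functional [m |-> '[m, f]]. *)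
Lemma orthprojP H (M : closedSubspace H) (f : H) (m : M) :
  '[val (orthproj M f), val m] = '[f, val m].
Proof.
apply/esym/eqP; rewrite -subr_eq0 -linearBl /=; apply/eqP.
suff /(xgetPex 0) : exists p : M, forall m : M, '[f - val p, val m] = 0
  by exact.
have [k u w|n|p pP] :=
  @riesz_representation M (hnorm f) (fun m : M => '[val m, f]).
- by rewrite linearP linearPl.
- by rewrite -hnormE mulrC inner_le.
exists p => n; rewrite linearBl /= form_conj pP.
by apply/eqP; rewrite subr_eq0 [eqbRHS](form_conj inner p n).
Qed.

Lemma orthproj_val H (M : closedSubspace H) (p : M) : orthproj M (val p) = p.
Proof.
by apply: inner_eq_l => m; rewrite form_conj [RHS]form_conj; congr Num.conj;
  apply: orthprojP.
Qed.

(** An adjoint relation with a bounded map forces linearity, as vectors are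
    determined by their inner products, and boundedness, because
    [|A x|^2 = '[x, B (A x)] <= c |x| |A x|].  This one argument covers
    adjoints, projections and inverses. *)
Lemma bounded_of_formal_adjoint E F (A : E -> F) (B : F -> E) (c : R) :
  (forall y, `|B y| <= c%:C * `|y|) ->
  (forall x y, '[A x, y] = '[x, B y]) -> bounded_operator A.
Proof.
move=> B_le AB; split=> [k u w|].
  apply: inner_eq_l => z; rewrite form_conj [RHS]form_conj; congr Num.conj.
  by rewrite AB !linearPl /= !AB.
exists `|c| => x; rewrite !hnormE -rmorphM lecR.
have [->|Ax0] := eqVneq (hnorm (A x)) 0; first by rewrite mulr_ge0 ?hnorm_ge0.
have {}Ax0 : 0 < hnorm (A x) by rewrite lt_def Ax0 hnorm_ge0.
rewrite -(ler_pM2r Ax0) -lecR -expr2 -qform_inner -qformE.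
rewrite -(ger0_norm (dnorm_ge0 inner (A x))) AB.
apply: le_trans (inner_le _ _) _.
rewrite !rmorphM /= -!hnormE -mulrA mulrCA ler_wpM2l//.
by apply: le_trans (B_le _) _; rewrite ler_wpM2r// lecR ler_norm.
Qed.

Lemma bounded_adjoint E F (A : E -> F) :
  bounded_operator A -> bounded_operator (adjoint A).
Proof.
move=> Abd; have [_ [c A_le]] := Abd.
apply: (bounded_of_formal_adjoint A_le) => y x.
by rewrite form_conj -adjointP// -form_conj.
Qed.

Lemma bounded_orthproj H (M : closedSubspace H) : bounded_operator (orthproj M).
Proof.
apply: (@bounded_of_formal_adjoint H M _ (val : M -> H) 1) => [m|f m].
  by rewrite mul1r.
exact: orthprojP.
Qed.

Lemma bounded_val H (M : closedSubspace H) : bounded_operator (val : M -> H).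
Proof.
by split=> [k u w|]; [rewrite linearP | exists 1 => m; rewrite mul1r].
Qed.

Lemma bounded_comp E F G (A : E -> F) (B : F -> G) :
  bounded_operator A -> bounded_operator B ->
  bounded_operator (fun x => B (A x)).
Proof.
move=> [A_lin [c A_le]] [B_lin [e B_le]]; split=> [k u w|].
  by rewrite A_lin B_lin.
exists (`|e| * c) => x; apply: le_trans (B_le _) _.
rewrite rmorphM -mulrA; apply: (@le_trans _ _ (`|e|%:C * `|A x|)).
  by rewrite ler_wpM2r// lecR ler_norm.
by rewrite ler_wpM2l// ler0c.
Qed.

Lemma bounded_scale E F (A : E -> F) (r : R) :
  bounded_operator A -> bounded_operator (fun x => r%:C *: A x).
Proof.
move=> [A_lin [c A_le]]; split=> [k u w|].
  by rewrite A_lin scalerDr !scalerA mulrC.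
exists (`|r| * c) => x; rewrite normrZ rmorphM -mulrA.
have -> : `|r%:C| = `|r|%:C :> R[i].
  by rewrite normc_def /= expr0n addr0 sqrtr_sqr.
by rewrite ler_wpM2l// ler0c.
Qed.

End bounded_operators.

(** * Operators bounded between two positive multiples of the identity *)
Section coercive_operators.
Context {R : realType} {H : hilbertType R}.
Variables (S : H -> H) (A B : R).
Hypothesis S_bounded : bounded_operator S.
Hypothesis A_gt0 : 0 < A.
Hypothesis B_gt0 : 0 < B.
Hypothesis S_between : forall f,
  A%:C * `|f| ^+ 2 <= '[S f, f] <= B%:C * `|f| ^+ 2.

(** Polarization: the quadratic form takes real values because the order of
    [R[i]] only compares numbers with equal imaginary parts. *)
Lemma coercive_hermitian x y : '[S x, y] = Num.conj '[S y, x].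
Proof.
have S_real f : complex.Im '[S f, f] = 0.
  apply: ger0_Im; have /andP[+ _] := S_between f; apply: le_trans.
  by rewrite mulr_ge0 ?exprn_ge0// ler0c ltW.
have polar s : complex.Im (Num.conj s * '[S x, y] + s * '[S y, x]) = 0.
  have := S_real (s *: y + x); rewrite S_bounded.1 linearPr /= !linearPl /=.
  move: (S_real x) (S_real y).
  case: '[S x, x] => xx1 _ /= ->; case: '[S y, y] => yy1 _ /= ->.
  case: '[S x, y] => a b; case: '[S y, x] => p q; case: s => s1 s2 /=; lra.
(* s = 1 compares the imaginary parts, s = 'i the real parts *)
move: (polar 1) (polar 'i); case: '[S x, y] => a b; case: '[S y, x] => p q /=.
move=> im1 imi; apply/eqP; rewrite eq_complex /=.
by apply/andP; split; apply/eqP; lra.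
Qed.

(** Making ['[S x, y]] an inner product gives access to Cauchy-Schwarz and to
    the representation of functionals by it. *)
Lemma coercive_dot :
  exists a : {dot H for Num.conj}, forall x y, a x y = '[S x, y].
Proof.
pose a x y := '[S x, y].
have a_bilin : bilinear_for *%R (Num.conj \; *%R : R[i] -> R[i] -> R[i]) a.
  split=> u k x y; rewrite /a; first by rewrite S_bounded.1 linearPl.
  by rewrite linearPr.
have a_herm u w : a u w = (-1) ^+ false * Num.conj (a w u).
  by rewrite mul1r /a -coercive_hermitian.
have a_gt0 u : u != 0 -> 0 < a u u.
  move=> u0; have /andP[+ _] := S_between u; apply: lt_le_trans.
  by rewrite mulr_gt0 ?exprn_gt0 ?normr_gt0// ltcR.
pose bm := @bilinear_isBilinear.Build R[i] H H R[i] _ _ a a_bilin.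
pose hm := @isHermitianSesquilinear.Build R[i] H false Num.conj a a_herm.
pose dm := @isDotProduct.Build R[i] H a a_gt0.
pose da : {dot H for Num.conj} := HB.pack a bm hm dm.
by exists da.
Qed.

Lemma coercive_formP (a : {dot H for Num.conj}) :
  (forall x y, a x y = '[S x, y]) ->
  (forall x, A * hnorm x ^+ 2 <= qform a x) /\
  (forall x, qform a x <= B * hnorm x ^+ 2).
Proof.
move=> aE; split=> x; have /andP[lo hi] := S_between x;
  by rewrite -lecR rmorphM rmorphXn /= -hnormE -qformE aE.
Qed.

(** Representing ['[x, y]] by the form ['[S x, z]] means [S z = y]. *)
Lemma coercive_surjective y : exists x, S x = y.
Proof.
have [a aE] := coercive_dot; have [a_ge a_le] := coercive_formP aE.
have [k u w|x|z zP] := @coercive_form_representation _ _ a A B (hnorm y)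
  (fun x => '[x, y]) A_gt0 B_gt0 a_ge a_le.
- by rewrite linearPl.
- by rewrite -hnormE mulrC inner_le.
exists z; apply: inner_eq_l => x.
by rewrite zP aE [RHS]coercive_hermitian -form_conj.
Qed.

Lemma coercive_lower x : A * hnorm x <= hnorm (S x).
Proof.
have [->|x0] := eqVneq (hnorm x) 0; first by rewrite mulr0 hnorm_ge0.
have {}x0 : 0 < hnorm x by rewrite lt_def x0 hnorm_ge0.
rewrite -(ler_pM2r x0) -mulrA -expr2 -lecR.
rewrite [leLHS]rmorphM [leRHS]rmorphM rmorphXn /= -!hnormE.
have /andP[lo _] := S_between x; apply: le_trans lo _.
apply: le_trans (inner_le _ _).
rewrite real_ler_norm// ger0_real//; have /andP[+ _] := S_between x.
by apply: le_trans; rewrite mulr_ge0 ?exprn_ge0// ler0c ltW.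
Qed.

(** A uniform bound on the quadratic form bounds the operator by the same
    constant: Cauchy-Schwarz for ['[S x, y]] at [y = S x] gives
    [|S x|^4 <= '[S x, x] '[S (S x), S x] <= B |x|^2 * B |S x|^2]. *)
Lemma coercive_upper x : hnorm (S x) <= B * hnorm x.
Proof.
have [a aE] := coercive_dot; have [a_ge a_le] := coercive_formP aE.
have := cauchy_schwarz a x (S x).
have -> : sqmod (a x (S x)) = hnorm (S x) ^+ 2 ^+ 2.
  by rewrite aE qformE qform_inner /sqmod /= expr0n addr0.
have := a_le x; have := a_le (S x); have := qform_ge0 a x.
have := hnorm_ge0 x; have := hnorm_ge0 (S x).
move: (hnorm x) (hnorm (S x)) (qform a x) (qform a (S x)) => n m p q.
move=> m0 n0 p0 qm pn mm.
have [->|mN0] := eqVneq m 0; first by rewrite mulr_ge0// ltW.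
have m2 : 0 < m ^+ 2 by rewrite exprn_gt0// lt_def mN0.
have B_ge0 := ltW B_gt0.
rewrite -(@ler_pXn2r _ 2) ?nnegrE ?mulr_ge0//.
rewrite -(ler_pM2r m2) -expr2; apply: le_trans mm _.
apply: (@le_trans _ _ (p * (B * m ^+ 2))); first by rewrite ler_wpM2l.
have -> : (B * n) ^+ 2 * m ^+ 2 = B * n ^+ 2 * (B * m ^+ 2) by ring.
by rewrite ler_wpM2r// mulr_ge0// ltW.
Qed.

Lemma opinvK y : S (opinv S y) = y.
Proof. by have /(xgetPex 0) := coercive_surjective y; exact. Qed.

Lemma opinv_self_adjoint x y : '[opinv S x, y] = '[x, opinv S y].
Proof.
rewrite -{1}(opinvK y) form_conj coercive_hermitian opinvK.
by rewrite -form_conj form_conj conjCK.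
Qed.

Lemma bounded_opinv : bounded_operator (opinv S).
Proof.
apply: (@bounded_of_formal_adjoint _ _ _ _ (opinv S) A^-1).
  move=> y; rewrite !hnormE -rmorphM lecR mulrC ler_pdivlMr// mulrC.
  by have := coercive_lower (opinv S y); rewrite opinvK.
exact: opinv_self_adjoint.
Qed.

End coercive_operators.

(** * The inverse frame operator resolves the identity *)

Theorem theorem4p1 (R : realType) (d : measure_display) (X : measurableType d)
    (mu : {measure set X -> \bar R})
    (H : hilbertType R) (K : X -> hilbertType R)
    (F : X -> closedSubspace H) (v : X -> R)
    (Lambda : forall x : X, F x -> K x)
    (T U : H -> H) (A B : R) (SC : H -> H)
    (H_separable : separable H)
    (Lambda_frame : controlled_gfusion_frame mu v Lambda T U A B)
    (SC_frame_operator : frame_operator mu v Lambda T U SC)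
    (SC_inv_T : opinv SC \o T = T \o opinv SC)
    (SC_inv_U : opinv SC \o U = U \o opinv SC) :
  let Tx (x : X) (f : H) : K x := Lambda x (orthproj (F x) (opinv SC f)) in
  resolution_of_identity mu
    (fun x f => (v x ^+ 2)%:C *:
       adjoint T (val (orthproj (F x) (val (adjoint (Lambda x) (Tx x (U f))))))) /\
  (forall f : H,
     let h x := (v x ^+ 2)%:C * '[Tx x (U f), Tx x (T f)] in
     cintegrable mu h /\
     (A / B ^+ 2)%:C * `|f| ^+ 2 <= cintegral mu h
       <= (B / A ^+ 2)%:C * `|f| ^+ 2).
Proof.
case: Lambda_frame => [[_ _ Lam_bd [T_bd _ _] [U_bd _ _]]].
move=> /andP[A0 AB] _ frame.
have B0 : 0 < B by apply: lt_le_trans AB.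
have A_ge0 := ltW A0; have B_ge0 := ltW B0.
have [S_bd S_weak] := SC_frame_operator.
(* moving T, P_x and Lambda_x to the other side of the inner product *)
have opE x y g :
    '[adjoint T (val (orthproj (F x) (val (adjoint (Lambda x) y)))), g] =
    '[y, Lambda x (orthproj (F x) (T g))].
  rewrite orthproj_val form_conj -adjointP// -form_conj.
  by rewrite form_conj -orthprojP [RHS]form_conj (adjointP (Lam_bd x)).
have S_diag f : '[SC f, f] = cintegral mu (fun x => (v x ^+ 2)%:C *
   '[Lambda x (orthproj (F x) (U f)), Lambda x (orthproj (F x) (T f))]).
  have [_ ->] := S_weak f f; congr cintegral.
  by apply/funext => x; rewrite opE.
have S_between f : A%:C * `|f| ^+ 2 <= '[SC f, f] <= B%:C * `|f| ^+ 2.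
  by rewrite S_diag; have [] := frame f.
have opinvT f : opinv SC (T f) = T (opinv SC f).
  exact: (congr1 (@^~ f) SC_inv_T).
have opinvU f : opinv SC (U f) = U (opinv SC f).
  exact: (congr1 (@^~ f) SC_inv_U).
have SK := opinvK S_bd A0 B0 S_between.
move=> Tx; split; first split.
- move=> x.
  have Tx_bd : bounded_operator (Tx x).
    exact: bounded_comp (bounded_comp
      (bounded_opinv S_bd A0 B0 S_between) (bounded_orthproj (F x))) (Lam_bd x).
  have adj_bd : bounded_operator (fun y =>
      adjoint T (val (orthproj (F x) (val (adjoint (Lambda x) y))))).
    have val_bd := bounded_val (F x).
    exact: bounded_comp (bounded_comp (bounded_comp (bounded_comp
      (bounded_adjoint (Lam_bd x)) val_bd) (bounded_orthproj (F x))) val_bd)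
      (bounded_adjoint T_bd).
  exact: bounded_scale (bounded_comp (bounded_comp U_bd Tx_bd) adj_bd).
- move=> f g; have [h_int h_eq] := S_weak (opinv SC f) g.
  have hE : (fun x => '[(v x ^+ 2)%:C *:
       adjoint T (val (orthproj (F x) (val (adjoint (Lambda x) (Tx x (U f)))))), g])
     = (fun x => (v x ^+ 2)%:C * '[adjoint T (val (orthproj (F x) (val
          (adjoint (Lambda x) (Lambda x (orthproj (F x) (U (opinv SC f)))))))), g]).
    by apply/funext => x; rewrite linearZl_LR /= /Tx opinvU.
  rewrite hE; split=> //; last by rewrite -h_eq SK.
  case: h_int => re im; split.
    exact/measurable_realfun.measurable_EFinP/(measurable_int mu re).
  exact/measurable_realfun.measurable_EFinP/(measurable_int mu im).
move=> f h; pose g := opinv SC f.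
have hE : h = (fun x => (v x ^+ 2)%:C *
   '[Lambda x (orthproj (F x) (U g)), Lambda x (orthproj (F x) (T g))]).
  by apply/funext => x; rewrite /h /Tx opinvU opinvT.
have [h_int /andP[lo hi]] := frame g.
rewrite hE; split=> //; apply/andP; split.
  apply: le_trans lo.
  rewrite !hnormE -!rmorphXn -!rmorphM lecR.
  have up := coercive_upper S_bd A0 B0 S_between g; rewrite SK in up.
  rewrite -mulrA ler_pM2l// mulrC ler_pdivrMr ?exprn_gt0// mulrC -exprMn.
  by rewrite ler_pXn2r ?nnegrE ?mulr_ge0 ?hnorm_ge0.
apply: le_trans hi _.
rewrite !hnormE -!rmorphXn -!rmorphM lecR.
have low := coercive_lower A0 S_between g; rewrite SK in low.
rewrite -mulrA ler_pM2l// [leRHS]mulrC ler_pdivlMr ?exprn_gt0// mulrC -exprMn.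
by rewrite ler_pXn2r ?nnegrE ?mulr_ge0 ?hnorm_ge0.
Qed.
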